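(* Let $X$ be a normed plane that is not isometrically isomorphic to $\ell_\infty^2$, and let $Y$ be a normed space with $\dim Y\geq 3$. Then a graph $G$ is $(X,Y)$-flattenable if and only if $G$ contains no $K_4$ minor.
   Context: All normed spaces are real and have dimension greater than zero; a normed plane is a 2-dimensional normed space; $\dim Y\ge 3$ includes infinite-dimensional $Y$. A graph $G=(V,E)$ is finite and simple with at least one edge. The measurement map of $(G,X)$ is $f_{G,X}:X^V\to\mathbb{R}^E$, $(x_v)_{v\in V}\mapsto(\|x_v-x_w\|_X)_{vw\in E}$. The graph $G$ is $(X,Y)$-flattenable if $f_{G,X}(X^V)\supseteq f_{G,Y}(Y^V)$. $\ell_\infty^2$ is $\mathbb{R}^2$ with the norm $\|(x_1,x_2)\|_\infty=\max(|x_1|,|x_2|)$. Isometrically isomorphic means there is a linear isometric bijection. $K_4$ is the complete graph on 4 vertices. A minor of a graph is any graph obtained from it by a sequence of edge deletions, edge contractions and deletions of isolated vertices. *)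

(* Defs.v *)
From HB Require Import structures.
From mathcomp Require Import all_boot all_order all_algebra.
From mathcomp Require Import all_classical all_reals all_analysis.

Set Implicit Arguments.
Unset Strict Implicit.
Unset Printing Implicit Defensive.

Import Order.TTheory GRing.Theory Num.Theory.
Import numFieldNormedType.Exports.

Local Open Scope classical_set_scope.
Local Open Scope ring_scope.

Section LinearAlgebra.
Variables (R : realType) (V : lmodType R) (n : nat).

Definition lin_indep (v : 'I_n -> V) : Prop :=
  forall a : 'I_n -> R, \sum_i a i *: v i = 0 -> forall i, a i = 0.

Definition spanning (v : 'I_n -> V) : Prop :=
  forall x, exists a : 'I_n -> R, x = \sum_i a i *: v i.

Definition dim_eq : Prop := exists v : 'I_n -> V, lin_indep v /\ spanning v.

(* Also true of every infinite-dimensional V. *)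
Definition dim_ge : Prop := exists v : 'I_n -> V, lin_indep v.

End LinearAlgebra.

Arguments dim_eq {R} V n.
Arguments dim_ge {R} V n.

Definition isometrically_isomorphic (R : realType) (V W : normedModType R) :
  Prop :=
  exists f : {linear V -> W}, bijective f /\ forall x, `|f x| = `|x|.

(* The norm which the library puts on row vectors is the sup norm. *)
Definition linf2 (R : realType) : normedModType R := 'rV[R]_2.

Lemma linf2_normE (R : realType) (x : 'rV[R]_2) :
  `|x : linf2 R| = Num.max `|x 0 0| `|x 0 1|.
Proof.
rewrite /Num.Def.normr /= mx_normrE.
apply/eqP; rewrite eq_le; apply/andP; split.
  apply/bigmax_leP; split=> [|[i j] _ /=]; first by rewrite le_max normr_ge0.
  rewrite (ord1 i) le_max; case: j => -[|[|//]] jlt.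
    by rewrite (_ : Ordinal jlt = 0) ?lexx//; exact: val_inj.
  by rewrite (_ : Ordinal jlt = 1) ?lexx ?orbT//; exact: val_inj.
by rewrite ge_max; apply/andP; split;
  [apply: (le_bigmax _ _ (0, 0)) | apply: (le_bigmax _ _ (0, 1))].
Qed.

Record sgraph := SGraph {
  vertex :> finType;
  adj : rel vertex;
  adj_sym : symmetric adj;
  adj_irr : irreflexive adj }.

Definition graph_iso (G H : sgraph) : Prop :=
  exists f : G -> H, bijective f /\ forall x y, adj (f x) (f y) = adj x y.

Section GraphOperations.
Variable G : sgraph.
Implicit Types u v : G.

Definition del_edge_rel u v : rel G := fun x y =>
  adj x y && ([set x; y]%SET != [set u; v]%SET).

Lemma del_edge_sym u v : symmetric (del_edge_rel u v).
Proof. by move=> x y; rewrite /del_edge_rel adj_sym finset.setUC. Qed.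

Lemma del_edge_irr u v : irreflexive (del_edge_rel u v).
Proof. by move=> x; rewrite /del_edge_rel adj_irr. Qed.

Definition del_edge u v : sgraph :=
  SGraph (del_edge_sym u v) (del_edge_irr u v).

Definition del_vertex_rel v : rel {x : G | x != v} := fun x y =>
  adj (val x) (val y).

Lemma del_vertex_sym v : symmetric (@del_vertex_rel v).
Proof. by move=> x y; rewrite /del_vertex_rel adj_sym. Qed.

Lemma del_vertex_irr v : irreflexive (@del_vertex_rel v).
Proof. by move=> x; rewrite /del_vertex_rel adj_irr. Qed.

Definition del_vertex v : sgraph :=
  SGraph (@del_vertex_sym v) (@del_vertex_irr v).

(* v is merged into u: the surviving vertex u inherits the neighbours of v,
   and the resulting loop and parallel edges are discarded. *)
Definition contract_rel u v : rel {x : G | x != v} := fun x y =>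
  (x != y) && [|| adj (val x) (val y),
                  (val x == u) && adj v (val y) |
                  (val y == u) && adj (val x) v].

Lemma contract_sym u v : symmetric (@contract_rel u v).
Proof.
move=> x y; rewrite /contract_rel eq_sym; congr (_ && (_ || _)).
  exact: adj_sym.
by rewrite orbC (adj_sym v (val x)) (adj_sym v (val y)).
Qed.

Lemma contract_irr u v : irreflexive (@contract_rel u v).
Proof. by move=> x; rewrite /contract_rel eqxx. Qed.

Definition contract_edge u v : sgraph :=
  SGraph (@contract_sym u v) (@contract_irr u v).

Definition isolated_vertex v : Prop := forall w : G, ~~ adj v w.

End GraphOperations.

(* minor H G: up to isomorphism, H is obtained from G by a sequence of edge
   deletions, edge contractions and deletions of isolated vertices. *)
Inductive minor (H : sgraph) : sgraph -> Prop :=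
| minor_iso (G : sgraph) : graph_iso H G -> minor H G
| minor_del_edge (G : sgraph) (u v : G) :
    adj u v -> minor H (del_edge u v) -> minor H G
| minor_contract (G : sgraph) (u v : G) :
    adj u v -> minor H (contract_edge u v) -> minor H G
| minor_del_isolated (G : sgraph) (v : G) :
    isolated_vertex v -> minor H (del_vertex v) -> minor H G.

Definition complete_rel (n : nat) : rel 'I_n := fun x y => x != y.

Lemma complete_sym n : symmetric (@complete_rel n).
Proof. by move=> x y; rewrite /complete_rel eq_sym. Qed.

Lemma complete_irr n : irreflexive (@complete_rel n).
Proof. by move=> x; rewrite /complete_rel eqxx. Qed.

Definition complete (n : nat) : sgraph :=
  SGraph (@complete_sym n) (@complete_irr n).

(* Each unordered edge vw is represented by exactly one of the pairs
   (v, w), (w, v), the one increasing in the enumeration of the vertices. *)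
Definition edge (G : sgraph) : finType :=
  {e : G * G | adj e.1 e.2 && (enum_rank e.1 < enum_rank e.2)%N}.

Definition measurement (R : realType) (X : normedModType R) (G : sgraph)
    (p : G -> X) : edge G -> R :=
  fun e => `|p (val e).1 - p (val e).2|.

Definition flattenable (R : realType) (X Y : normedModType R) (G : sgraph) :
  Prop :=
  range (@measurement R Y G) `<=` range (@measurement R X G).

(* Main.v *)
From HB Require Import structures.
Require Import Defs.
From mathcomp Require Import all_boot all_order all_algebra.
From mathcomp Require Import all_classical all_reals all_analysis.
From mathcomp Require Import zify ring lra.

Set Implicit Arguments.
Unset Strict Implicit.
Unset Printing Implicit Defensive.

Import Order.TTheory GRing.Theory Num.Theory.
Import numFieldNormedType.Exports.

Local Open Scope classical_set_scope.
Local Open Scope ring_scope.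

(** A graph without [K_4] minor has a vertex [v] with at most two neighbours.
    Contracting an edge at [v] leaves a smaller graph without [K_4] minor in which
    two neighbours of [v] are adjacent, so that by induction it flattens with
    the distance between these neighbours preserved.  Putting
    [v] back asks for a third point at given distances from two given ones, and
    in dimension at least two the triangle inequalities are the only obstruction
    to that: move along the sphere around the first point
    ([triangle_completion]).  This half holds for every normed plane.  The
    graph-theoretic input, Dirac's theorem that minimum degree three forces a
    [K_4] minor, comes from a longest path with a shortest possible chord at its
    end ([min_degree3_K4_branch_sets]).

    Conversely, flattenability is inherited by minors, so it is enough to see
    that [K_4] is not flattenable.  By a theorem of Petty, a normed space of
    dimension at least three contains four points at mutual distance one
    ([four_equidistant_points]).  In a plane, four such points must be the ends
    of two segments that bisect each other, because none of them can be a convex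
    combination of the other three; comparing sides and diagonals of this
    parallelogram then shows that the unit ball is a parallelogram, that is,
    that the plane is isometric to the sup norm plane ([equidistant4_l1_pair],
    [l1_pair_linf2]).

    For Petty's theorem, fix a unit vector [x] and look at the set [C] of the
    [y] with [|y| = |y - x| = 1].  It is stable under [y |-> x - y], and [y] is
    at distance [|2 y - x| >= 1] from its image.  If [C] is followed from a point
    to the image of that point, the distance to the starting point goes from [0]
    to at least [1], hence takes the value [1] at some [z]; then [0], [x], [y],
    [z] are equidistant.  The set [C] need not be a curve, since its intersection
    with a half-plane bounded by the line of [x] can be a segment parallel to [x]
    instead of a point.  So the path is replaced by the connectedness of the
    interval of half-planes, with the segments as fibres
    ([closed_cover_meet]). *)

(** * Branch sets of complete minors *)

(** Connectedness of the subgraph induced on [P], stated by cuts because this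
    form survives a contraction by pulling the cut back. *)
Definition cut_connected (G : sgraph) (P : G -> Prop) : Prop :=
  forall S : {set G},
    (exists2 x, P x & x \in S) -> (exists2 y, P y & y \notin S) ->
    exists x y, [/\ P x, P y, x \in S, y \notin S & adj x y].

(** The vertices sent to [Some c] form the [c]-th branch set of a [K_n] minor;
    those sent to [None] belong to no branch set. *)
Definition branch_sets (n : nat) (G : sgraph) (phi : G -> option 'I_n) :=
  [/\ forall c, exists x, phi x = Some c,
      forall c, cut_connected (fun x => phi x = Some c) &
      forall c d, c != d ->
        exists x y, [/\ phi x = Some c, phi y = Some d & adj x y]].

(** One transfer principle serves for contractions and for deletions: [r]
    is the map of [G] onto the smaller graph, of which only the values on the
    branch sets matter. *)
Lemma branch_sets_image (n : nat) (G H : sgraph) (phi : G -> option 'I_n)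
    (psi : H -> option 'I_n) (r : G -> H) :
  (forall y, exists2 x, r x = y & phi x = psi y) ->
  (forall x, phi x -> psi (r x) = phi x) ->
  (forall x y, phi x -> phi y -> adj x y -> r x != r y -> adj (r x) (r y)) ->
  branch_sets phi -> branch_sets psi.
Proof.
move=> r_surj psi_r adj_r.
have phiS x c : phi x = Some c -> phi x /\ psi (r x) = Some c.
  by move=> px; have px' : phi x; rewrite ?px// psi_r.
move=> [ne conn touch]; split=> /=.
- by move=> c; have [x /phiS[_ xc]] := ne c; exists (r x).
- move=> c S [x' xc xS] [y' yc yS].
  have [x xE px] := r_surj x'; have [y yE py] := r_surj y'.
  move: xc xS yc yS; rewrite -px -py -xE -yE => xc xS yc yS.
  have [||a [b []]] := conn c [set z | r z \in S]%SET.
  + by exists x => //; rewrite inE.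
  + by exists y => //; rewrite inE.
  rewrite !inE => /phiS[a0 ac] /phiS[b0 bc] aS bS ab.
  exists (r a), (r b); split=> //; apply: adj_r => //.
  by apply: contraNneq bS => <-.
- move=> c d cd; have [x [y [/phiS[x0 xc] /phiS[y0 yd] xy]]] := touch c d cd.
  exists (r x), (r y); split=> //; apply: adj_r => //.
  by apply: contra_neq cd => e; move: xc; rewrite e yd => -[].
Qed.

Lemma card_removed (G : sgraph) (v : G) : #|{: {x : G | x != v}}| = #|G|.-1.
Proof. by rewrite card_sig -(cardC1 v); apply: eq_card. Qed.

(** A vertex outside the branch sets is either isolated, and deleted, or
    contracted into a neighbour; an edge inside a branch set is contracted.  Edge
    deletions never occur, because the graph that remains when neither move
    applies has singleton branch sets that are pairwise adjacent: it is complete. *)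
Lemma branch_sets_minor (n : nat) (G : sgraph) (phi : G -> option 'I_n) :
  branch_sets phi -> minor (complete n) G.
Proof.
have [m] := ubnP #|G|; elim: m G phi => // m IH G phi leG bs.
have small (v : G) : (#|{: {x : G | x != v}}| < m)%N.
  rewrite card_removed; have : (0 < #|G|)%N by apply/card_gt0P; exists v.
  by move: leG; lia.
have shrink (u v : G) : adj u v -> (phi v -> phi v = phi u) ->
    minor (complete n) G.
  move=> uv phi_v; have u_v : u != v.
    by apply: contraTneq uv => ->; rewrite adj_irr.
  apply: (minor_contract uv).
  apply: (IH (contract_edge u v) (fun x => phi (val x)) (small v)).
  pose r (x : G) : contract_edge u v := insubd (exist _ u u_v) x.
  have rE x : val (r x) = if x == v then u else x.
    by rewrite val_insubd; case: eqP.
  apply: (@branch_sets_image _ _ (contract_edge u v) phi _ r) => //.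
  - move=> y; exists (val y) => //.
    by apply: val_inj; rewrite rE (negbTE (valP y)).
  - by move=> x /= px; rewrite rE; case: eqP px => // -> /phi_v.
  - move=> x y _ _ xy rxy; rewrite /= /contract_rel rxy/= !rE.
    case: (x =P v) xy => [->|_]; case: (y =P v) => [->|_] //= xy;
      rewrite ?eqxx ?xy ?orbT //.
    by rewrite adj_irr in xy.
have [v /eqP phi_v|inside] := pickP (fun v => phi v == None).
  have [u uv|isol] := pickP (fun u => adj u v).
    by apply: (shrink u v) => //; rewrite phi_v.
  apply: (@minor_del_isolated _ _ v) => [w|]; first by rewrite adj_sym isol.
  apply: (IH (del_vertex v) (fun x => phi (val x)) (small v)).
  have [/= u u_v|only_v] := pickP (fun u => u != v).
    pose r (x : G) : del_vertex v := insubd (exist _ u u_v) x.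
    have rE x : phi x -> val (r x) = x.
      by rewrite val_insubd; case: eqP => //= ->; rewrite phi_v.
    apply: (@branch_sets_image _ _ (del_vertex v) phi _ r) => //.
    - move=> y; exists (val y) => //; apply: val_inj.
      by rewrite val_insubd (valP y).
    - by move=> x px /=; rewrite rE.
    - by move=> x y px py xy _; rewrite /= /del_vertex_rel !rE.
  have phi0 x : phi x = None by have /negbFE/eqP -> := only_v x.
  by have [ne _ _] := bs; split=> c; have [x] := ne c; rewrite phi0.
have [/= [u v] /andP[/= uv /eqP e]|sep] :=
  pickP (fun e : G * G => adj e.1 e.2 && (phi e.1 == phi e.2)).
  by apply: (shrink u v).
have [ne conn touch] := bs.
have inj_phi : injective phi.
  move=> x y xy; apply: contrapT => /eqP neq.
  case xc: (phi x) (inside x) => [c|] // _.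
  have [||a [b [ac bc _ _ ab]]] := conn c [set x]%SET.
  - by exists x; rewrite ?inE.
  - by exists y; rewrite ?inE 1?eq_sym // -xy.
  by have := sep (a, b); rewrite /= ab ac bc eqxx.
have [f fE] := choice ne.
apply: minor_iso; exists f; split.
  have phiP x : {c | phi x = Some c}.
    by case: (phi x) (inside x) => // c; exists c.
  exists (fun x => sval (phiP x)) => [c|x].
    by case: phiP => d /=; rewrite fE => -[].
  by case: phiP => d /= xd; apply: inj_phi; rewrite fE.
move=> c d; apply/idP/idP => [|/touch[x [y [xc yd xy]]]].
  by apply: contraTneq => ->; rewrite adj_irr.
have -> : f c = x by apply: inj_phi; rewrite fE.
by have -> : f d = y by apply: inj_phi; rewrite fE.
Qed.

(** * Graphs of minimum degree three *)
Lemma crossing_step (Q : pred nat) (i j : nat) : (i <= j)%N -> Q i -> ~~ Q j ->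
  exists m, [/\ (i <= m < j)%N, Q m & ~~ Q m.+1].
Proof.
elim: j => [|j IH]; first by rewrite leqn0 => /eqP-> ->.
rewrite leq_eqVlt => /predU1P[-> ->//|ij Qi Qj].
have [Qj'|Qj'] := boolP (Q j).
  by exists j; rewrite ltnS in ij; rewrite ij/= ltnSn.
by have [m [im Qm Qm']] := IH ij Qi Qj'; exists m; split=> //; lia.
Qed.

(** Cutting a path into consecutive segments yields connected sets, so that to
    obtain a complete minor only the adjacencies between segments are to be
    checked.  The segments are the fibres of a monotone map on positions. *)
Lemma path_branch_sets (n : nat) (G : sgraph) (x0 : G) (s : seq G)
    (cls : nat -> 'I_n) :
  sorted (@adj G) s -> uniq s -> {homo cls : i j / (i <= j)%N} ->
  (forall c, exists2 i, (i < size s)%N & cls i = c) ->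
  (forall c d : 'I_n, (c < d)%N -> exists i j,
    [/\ (i < size s)%N, (j < size s)%N, cls i = c, cls j = d &
        adj (nth x0 s i) (nth x0 s j)]) ->
  branch_sets (fun x => if x \in s then Some (cls (index x s)) else None).
Proof.
move=> /(sortedP x0) step us mono onto touch.
have phi_nth i : (i < size s)%N ->
    (if nth x0 s i \in s then Some (cls (index (nth x0 s i) s)) else None) =
    Some (cls i).
  by move=> ilt; rewrite mem_nth// index_uniq.
split.
- by move=> c; have [i ilt <-] := onto c; exists (nth x0 s i); rewrite phi_nth.
- move=> c S [x xc xS] [y yc yS].
  case: ifP xc => // xs [xc]; case: ifP yc => // ys [yc].
  have cls_between k a b : cls a = c -> cls b = c -> (a <= k <= b)%N ->
      cls k = c.
    move=> ac bc /andP[/mono ak /mono kb]; apply/val_inj/eqP.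
    by rewrite eqn_leq -{1}bc kb -ac.
  have xlt : (index x s < size s)%N by rewrite index_mem.
  have ylt : (index y s < size s)%N by rewrite index_mem.
  pose Q i := nth x0 s i \in S.
  have [xy|/ltnW yx] := leqP (index x s) (index y s).
    have [||m [/andP[im mj] mS mS']] := crossing_step (Q := Q) xy;
      rewrite /Q ?nth_index//.
    exists (nth x0 s m), (nth x0 s m.+1); rewrite !phi_nth; try lia.
    split=> //; try by rewrite (cls_between _ _ _ xc yc)//; lia.
    by apply: step; lia.
  have [||m [/andP[im mj] mS mS']] := crossing_step (Q := predC Q) yx;
    rewrite /= /Q ?nth_index ?negbK//.
  exists (nth x0 s m.+1), (nth x0 s m); rewrite !phi_nth; try lia.
  split=> //; try by rewrite (cls_between _ _ _ yc xc)//; lia.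
    by rewrite -[_ \in _]negbK.
  by rewrite adj_sym; apply: step; lia.
- suff lt_touch (c d : 'I_n) : (c < d)%N -> exists x y,
      [/\ (if x \in s then Some (cls (index x s)) else None) = Some c,
          (if y \in s then Some (cls (index y s)) else None) = Some d & adj x y].
    move=> c d; rewrite neq_ltn => /orP[/lt_touch//|/lt_touch[x [y [xd yc xy]]]].
    by exists y, x; split=> //; rewrite adj_sym.
  move=> /touch[i [j [ilt jlt ic jd ij]]].
  by exists (nth x0 s i), (nth x0 s j); rewrite !phi_nth// ic jd.
Qed.

Lemma longest_path (G : sgraph) (x : G) : exists s : seq G,
  [/\ sorted (@adj G) s, uniq s, (0 < size s)%N &
      forall t, sorted (@adj G) t -> uniq t -> (size t <= size s)%N].
Proof.
pose P k := `[< exists s : seq G, [/\ sorted (@adj G) s, uniq s & size s = k] >].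
have P1 : P 1%N by apply/asboolP; exists [:: x].
have bound k : P k -> (k <= #|G|)%N.
  by move=> /asboolP[s [_ /card_uniqP<- <-]]; exact: max_card.
case: (ex_maxnP (ex_intro (fun k => P k) _ P1) bound) => k.
move=> /asboolP[s [ss us <-]] kmax.
exists s; split=> //; first exact: kmax.
by move=> t st ut; apply: kmax; apply/asboolP; exists t.
Qed.

(** Dirac's theorem; the hypothesis says that no vertex has all its neighbours
    among two vertices.  All neighbours of the first vertex of a longest path [s]
    lie on [s].  Among all longest paths and all chords [s_0 s_i] with [i >= 2],
    take one with [i] minimal.  A third neighbour [s_j] of [s_0] then has
    [j > i].  Reversing [s_0 .. s_(i-1)] and entering [s_i] by the chord gives
    another longest path, which starts at [s_(i-1)], so that likewise [s_(i-1)]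
    is adjacent to some [s_l] with [l > i].  The four segments
    [s_0 .. s_(i-2)], [s_(i-1)], [s_i] and [s_(i+1) ..] are pairwise adjacent. *)
Lemma min_degree3_K4_branch_sets (G : sgraph) (x0 : G) :
  (forall v a b : G, exists c, [/\ adj v c, c != a & c != b]) ->
  exists phi : G -> option 'I_4, branch_sets phi.
Proof.
move=> deg3; have [s0 [ss0 us0 s0_gt0 s0max]] := longest_path x0.
pose k := size s0.
pose longest s := [/\ sorted (@adj G) s, uniq s & size s = k].
have longest_nbr s (a b : nat) : longest s -> exists j,
    [/\ (0 < j < k)%N, j != a, j != b & adj (nth x0 s 0) (nth x0 s j)].
  move=> [ss us sk].
  have [y [vy ya yb]] := deg3 (nth x0 s 0) (nth x0 s a) (nth x0 s b).
  have ys : y \in s.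
    have [//|ys] := boolP (y \in s).
    have : (size (y :: s) <= k)%N.
      apply: s0max; rewrite /= ?ys// .
      by case: (s) ss vy => //= z t -> ; rewrite adj_sym => ->.
    by rewrite /= sk ltnn.
  exists (index y s); rewrite -sk index_mem ys nth_index// andbT; split=> //.
  - rewrite lt0n; apply: contraTneq vy => y0.
    by rewrite -[y](nth_index x0 ys) y0 adj_irr.
  - by apply: contra_neq ya => <-; rewrite nth_index.
  - by apply: contra_neq yb => <-; rewrite nth_index.
pose chord i s := [/\ longest s, (1 < i < k)%N & adj (nth x0 s 0) (nth x0 s i)].
have ex_chord : exists i, `[< exists s, chord i s >].
  have l0 : longest s0 by [].
  have [i [ik i1 _ si]] := longest_nbr s0 1%N 1%N l0.
  by exists i; apply/asboolP; exists s0; split=> //; lia.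
case: (ex_minnP ex_chord) => i /asboolP[s [ls ik si]] imin {ex_chord}.
have jump t : longest t ->
    exists2 j, (i < j < k)%N & adj (nth x0 t 0) (nth x0 t j).
  move=> lt; have [j [jk j1 ji tj]] := longest_nbr t 1%N i lt.
  exists j => //; have : (i <= j)%N; last by lia.
  by apply: imin; apply/asboolP; exists t; split=> //; lia.
have [ss us sk] := ls; have /(sortedP x0) step := ss.
have [j jk sj] := jump _ ls.
(* Position [m] of the new path is position [flip m] of the old one. *)
pose flip m := if (m < i)%N then (i.-1 - m)%N else m.
have i_gt0 : (0 < i)%N by lia.
have flip_inj : injective flip.
  move=> a b; rewrite /flip; clear -i_gt0.
  by case: ltnP => ai; case: ltnP => bi; lia.
have flip_lt m : (m < k)%N -> (flip m < k)%N.
  by by rewrite /flip; case: (ltnP m i) => // mi mk; clear -ik mk mi; lia.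
pose t := mkseq (fun m => nth x0 s (flip m)) k.
have lt : longest t.
  split; last by rewrite size_mkseq.
  - apply/(sortedP x0) => m; rewrite size_mkseq => mk.
    rewrite !nth_mkseq ?(ltnW mk)// /flip.
    have [mi|im] := ltnP m.+1 i.
      rewrite (ltn_trans _ mi)// adj_sym.
      rewrite (_ : i.-1 - m = (i.-1 - m.+1).+1)%N; last by lia.
      by apply: step; lia.
    have [mi|mi] := ltnP m i.
      have -> : (i.-1 - m = 0)%N by lia.
      by have -> : (m.+1 = i)%N by lia.
    by apply: step; rewrite sk.
  - apply/mkseq_uniqP => a b; rewrite !inE => ak bk /eqP.
    by rewrite nth_uniq ?sk ?flip_lt// => /eqP/flip_inj.
have [l lk tl] := jump _ lt.
have {}tl : adj (nth x0 s i.-1) (nth x0 s l).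
  have /andP[il l_k] := lk; move: tl.
  rewrite !nth_mkseq ?(leq_trans _ l_k)// /flip.
  by rewrite i_gt0 subn0 ltnNge ltnW.
pose cls m : 'I_4 := inord ((i.-1 <= m) + (i <= m) + (i < m)).
have clsE m (c : 'I_4) : ((i.-1 <= m) + (i <= m) + (i < m))%N = c -> cls m = c.
  by move=> e; apply: val_inj; rewrite /= inordK ?e ?ltn_ord.
exists (fun x => if x \in s then Some (cls (index x s)) else None).
apply: (path_branch_sets (x0 := x0)) => //.
- move=> a b ab; rewrite /cls !inordK; clear -ab; lia.
- move=> c; exists (nth 0%N [:: 0; i.-1; i; i.+1]%N c).
    by rewrite sk; case: c => -[|[|[|[|]]]] //= _; lia.
  by apply: clsE; case: c => -[|[|[|[|]]]] //= _; lia.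
- suff edges (c d a b : nat) : (c, d, a, b) \in
        [:: (0, 1, i.-2, i.-1); (0, 2, 0, i); (0, 3, 0, j);
            (1, 2, i.-1, i); (1, 3, i.-1, l); (2, 3, i, i.+1)]%N ->
      [/\ (a < k)%N, (b < k)%N,
         ((i.-1 <= a) + (i <= a) + (i < a))%N = c,
         ((i.-1 <= b) + (i <= b) + (i < b))%N = d &
         adj (nth x0 s a) (nth x0 s b)].
    move=> c d cd.
    have [a [b /edges[ak bk ac bd ab]]] : exists a b, (val c, val d, a, b) \in
        [:: (0, 1, i.-2, i.-1); (0, 2, 0, i); (0, 3, 0, j);
            (1, 2, i.-1, i); (1, 3, i.-1, l); (2, 3, i, i.+1)]%N.
      case: c cd => -[|[|[|[|//]]]] lc; case: d => -[|[|[|[|//]]]] ld //= _.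
      + by exists i.-2, i.-1; rewrite !inE !eqxx ?orbT.
      + by exists 0%N, i; rewrite !inE !eqxx ?orbT.
      + by exists 0%N, j; rewrite !inE !eqxx ?orbT.
      + by exists i.-1, i; rewrite !inE !eqxx ?orbT.
      + by exists i.-1, l; rewrite !inE !eqxx ?orbT.
      + by exists i, i.+1; rewrite !inE !eqxx ?orbT.
    by exists a, b; rewrite sk; split=> //; apply: clsE.
  rewrite !inE => /orP[|/orP[|/orP[|/orP[|/orP[]]]]] /eqP[-> -> -> ->];
    split=> //; try lia.
  + have -> : i.-1 = i.-2.+1 by lia.
    by apply: step; lia.
  + have {2}-> : i = i.-1.+1 by lia.
    by apply: step; lia.
  + by apply: step; lia.
Qed.

(** * Flattenability and minors *)

Section Flattenability.
Variables (R : realType) (X Y : normedModType R).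

Lemma flattenableP (G : sgraph) : flattenable X Y G <->
  forall p : G -> Y, exists q : G -> X,
    forall x y, adj x y -> `|q x - q y| = `|p x - p y|.
Proof.
split=> [flat p|flat _ [p _ <-]].
  have [q _ qp] := flat _ (ex_intro2 _ _ p I erefl).
  exists q => x y xy.
  wlog lt_xy : x y xy / (enum_rank x < enum_rank y)%N.
    move=> H; have [/H->//|/H e|/val_inj/enum_rank_inj->] :=
      ltngtP (enum_rank x) (enum_rank y).
      by rewrite distrC e 1?distrC// adj_sym.
    by rewrite !subrr !normr0.
  have xyP : adj (x, y).1 (x, y).2 &&
      (enum_rank (x, y).1 < enum_rank (x, y).2)%N.
    by rewrite xy.
  by have := congr1 (fun m : edge G -> R => m (exist _ (x, y) xyP)) qp.
have [q qp] := flat p; exists q => //.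
by apply: funext => e; have /andP[ee _] := valP e; apply: qp.
Qed.

(** A placement of a contracted graph is a placement of [G] with two coinciding
    points; their distance zero is preserved, so the flattened points coincide
    as well. *)
Lemma flattenable_minor (H G : sgraph) :
  minor H G -> flattenable X Y G -> flattenable X Y H.
Proof.
elim=> {G} [G [f [[g fK gK] fadj]]|G u v uv _ IH|G u v uv _ IH|G v v0 _ IH]
  /flattenableP flat; do ?apply: IH; apply/flattenableP => p.
- have [q qp] := flat (p \o g); exists (q \o f) => x y xy.
  by rewrite /= qp ?fadj//= !fK.
- have [q qp] := flat p; exists q => x y /andP[xy _]; exact: qp.
- have u_v : u != v by apply: contraTneq uv => ->; rewrite adj_irr.
  pose r (x : G) : contract_edge u v := insubd (exist _ u u_v) x.
  have rE (x : contract_edge u v) : r (val x) = x by rewrite /r valKd.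
  have rv : r v = r u.
    by apply: val_inj; rewrite !val_insubd eqxx u_v.
  have [q qp] := flat (p \o r).
  have quv : q v = q u.
    by apply/eqP; rewrite eq_sym -subr_eq0 -normr_eq0 qp//= rv subrr normr0.
  exists (q \o val) => x y /= /andP[_].
  move=> /or3P[xy|/andP[/eqP xu vy]|/andP[/eqP yu xv]].
  + by rewrite qp//= !rE.
  + by rewrite xu -quv qp//= rv -xu !rE.
  + by rewrite yu -quv qp//= rv -yu !rE.
- have [q qp] := flat (fun x => oapp p 0 (insub x)).
  by exists (q \o val) => x y xy; rewrite /= qp//= !valK.
Qed.

(** Contracting [v] into a neighbour [u] joins [u] to the other neighbour [w] of
    [v], so that the flattening of the smaller graph preserves the distance from
    [u] to [w] and the triangle [u], [w], [v] can be completed. *)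
Lemma K4_minor_free_flattenable (G : sgraph) :
  (forall (u w : X) a b, `|a - b| <= `|u - w| <= a + b ->
    exists z, `|z - u| = a /\ `|z - w| = b) ->
  ~ minor (complete 4) G -> flattenable X Y G.
Proof.
move=> triangle; have [m] := ubnP #|G|; elim: m G => // m IH G leG noK4.
have small (v : G) : (#|{: {x : G | x != v}}| < m)%N.
  rewrite card_removed; have : (0 < #|G|)%N by apply/card_gt0P; exists v.
  by move: leG; lia.
have [x0|noG] := pselect (exists x : G, True); last first.
  by apply/flattenableP => p; exists (fun=> 0) => x; case: noG; exists x.
have [v [a [b vab]]] :
    exists v a b : G, forall w, adj v w -> w = a \/ w = b.
  apply: contrapT => deg3; apply: noK4; case: x0 => x0 _.
  suff [phi] : exists phi : G -> option 'I_4, branch_sets phi.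
    exact: branch_sets_minor.
  apply: min_degree3_K4_branch_sets x0 _ => v a b; apply: contrapT => no_c.
  apply: deg3; exists v, a, b => w vw; apply: contrapT => wab.
  by apply: no_c; exists w; split=> //; apply/eqP => e; apply: wab; [left|right].
apply/flattenableP => p.
have [u uv|isol] := pickP (fun u => adj u v); last first.
  have : flattenable X Y (del_vertex v).
    apply: (IH (del_vertex v) (small v)) => K4; apply: noK4.
    apply: minor_del_isolated K4.
    by move=> w; rewrite adj_sym isol.
  move=> /flattenableP/(_ (p \o val))[q qp].
  exists (fun x => oapp q 0 (insub x)) => x y xy.
  have xv : x != v by apply: contraFneq (isol y) => <-; rewrite adj_sym.
  have yv : y != v by apply: contraFneq (isol x) => <-.
  by rewrite !insubT/= qp.
(* The second neighbour [w] may coincide with [u], or not be a neighbour. *)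
have [w vuw] : exists w, forall x, adj v x -> x = u \/ x = w.
  have [ua|ub] := vab u (etrans (adj_sym _ _) uv).
    by exists b; rewrite ua.
  by exists a => x /vab[]; [right|left; rewrite ub].
have u_v : u != v by apply: contraTneq uv => ->; rewrite adj_irr.
have : flattenable X Y (contract_edge u v).
  apply: (IH (contract_edge u v) (small v)) => K4; apply: noK4.
  exact: minor_contract K4.
move=> /flattenableP/(_ (p \o val))[q qp].
pose q' (x : G) := oapp q 0 (insub x).
have q'p x y : x != v -> y != v -> adj x y -> `|q' x - q' y| = `|p x - p y|.
  move=> xv yv xy; rewrite /q' !insubT qp//= /contract_rel/= xy andbT.
  by apply: contraTneq xy => -[->]; rewrite adj_irr.
have [z [zu zw]] : exists z, `|z - q' u| = `|p v - p u| /\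
    (adj v w -> `|z - q' w| = `|p v - p w|).
  have [vw|] := boolP (adj v w); last first.
    have [|z [zu _]] := triangle (q' u) (q' u) `|p v - p u| `|p v - p u|.
      by rewrite !subrr !normr0 lexx addr_ge0.
    by exists z; rewrite zu.
  have w_v : w != v by apply: contraTneq vw => ->; rewrite adj_irr.
  have quw : `|q' u - q' w| = `|p u - p w|.
    have [<-|uw] := eqVneq u w; first by rewrite !subrr !normr0.
    rewrite /q' !insubT qp//= /contract_rel/= eqxx vw/= orbT andbT.
    by apply: contra_neq uw => -[].
  have [|z [zu zw]] := triangle (q' u) (q' w) `|p v - p u| `|p v - p w|.
    rewrite quw; apply/andP; split.
      rewrite (le_trans (ler_dist_dist _ _))// opprB addrC addrA subrK distrC//.
    by rewrite [`|p v - p u|]distrC (le_trans _ (ler_normD _ _))// addrA subrK.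
  by exists z; rewrite zu zw.
exists (fun x => if x == v then z else q' x) => x y.
have z_nbr c : adj v c -> `|z - q' c| = `|p v - p c|.
  by move=> vc; have [->//|cw] := vuw c vc; rewrite cw in vc *; exact: zw.
case: (x =P v) => [->|/eqP xv]; case: (y =P v) => [->|/eqP yv] xy.
- by rewrite adj_irr in xy.
- exact: z_nbr.
- by rewrite distrC z_nbr 1?distrC// adj_sym.
- exact: q'p.
Qed.

End Flattenability.

(** * Identities between linear combinations *)

(** Identities between linear combinations are proved by reflection: both sides
    are reified as expressions over a list of vectors, and the identity follows
    once the coefficients of each vector agree. *)
Section LinearIdentities.
Variables (R : realType) (V : lmodType R).

Inductive linexp :=
| LVar of nat | LZero | LAdd of linexp & linexp | LOpp of linexp
| LScale of R & linexp.

Fixpoint lin_eval (env : seq V) (e : linexp) : V :=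
  match e with
  | LVar i => env`_i
  | LZero => 0
  | LAdd a b => lin_eval env a + lin_eval env b
  | LOpp a => - lin_eval env a
  | LScale k a => k *: lin_eval env a
  end.

Fixpoint lin_coef (e : linexp) (i : nat) : R :=
  match e with
  | LVar j => if eqn j i then 1 else 0
  | LZero => 0
  | LAdd a b => lin_coef a i + lin_coef b i
  | LOpp a => - lin_coef a i
  | LScale k a => k * lin_coef a i
  end.

Fixpoint lin_bounded (n : nat) (e : linexp) : bool :=
  match e with
  | LVar i => (i < n)%N
  | LZero => true
  | LAdd a b => lin_bounded n a && lin_bounded n b
  | LOpp a | LScale _ a => lin_bounded n a
  end.

Fixpoint lin_agree (n : nat) (e f : linexp) : Prop :=
  if n is m.+1 then lin_agree m e f /\ lin_coef e m = lin_coef f m else True.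

Lemma lin_evalE env e : lin_bounded (size env) e ->
  lin_eval env e = \sum_(i < size env) lin_coef e i *: env`_i.
Proof.
elim: e => [j|_|a IHa b IHb /=|a IHa /=|k a IHa /=].
- move=> /= jn; rewrite (bigD1 (Ordinal jn))//= (introT eqnP erefl) scale1r.
  rewrite big1 ?addr0// => i.
  by rewrite -val_eqE/= eq_sym; case: eqnP => [->|_]; rewrite ?eqxx// scale0r.
- by rewrite /= big1// => i _; rewrite scale0r.
- move=> /andP[/IHa-> /IHb->]; rewrite -big_split.
  by apply: eq_bigr => i _; rewrite /= scalerDl.
- by move=> /IHa->; rewrite -sumrN; apply: eq_bigr => i _; rewrite /= scaleNr.
- move=> /IHa->; rewrite scaler_sumr.
  by apply: eq_bigr => i _; rewrite /= scalerA.
Qed.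

Lemma lin_agreeP env e f :
  lin_bounded (size env) e && lin_bounded (size env) f ->
  lin_agree (size env) e f -> lin_eval env e = lin_eval env f.
Proof.
move=> /andP[be bf] agree; rewrite !lin_evalE//; apply: eq_bigr => i _.
congr (_ *: _); case: i => i /=.
elim: (size env) agree => //= n IH [agree_n en]; rewrite ltnS leq_eqVlt.
by case/predU1P => [->|]; [exact: en|exact: IH].
Qed.

End LinearIdentities.

Ltac lin_index x xs :=
  lazymatch xs with
  | x :: _ => constr:(0%N)
  | _ :: ?ys => let i := lin_index x ys in constr:(i.+1)
  end.

Ltac lin_reify R xs t :=
  lazymatch t with
  | GRing.add ?a ?b =>
      let a' := lin_reify R xs a in let b' := lin_reify R xs b in
      constr:(LAdd a' b')
  | GRing.opp ?a => let a' := lin_reify R xs a in constr:(LOpp a')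
  | GRing.scale ?k ?a => let a' := lin_reify R xs a in constr:(@LScale R k a')
  | GRing.zero => constr:(@LZero R)
  | _ => let i := lin_index t xs in constr:(@LVar R i)
  end.

(** Leaves one equation between scalars for each vector of [xs]. *)
Ltac lin_coefficients R xs :=
  lazymatch goal with
  | |- ?a = ?b =>
      let a' := lin_reify R xs a in let b' := lin_reify R xs b in
      apply: (@lin_agreeP R _ xs a' b');
      [reflexivity | cbn [lin_agree lin_coef eqn size]; do ?split]
  end.

(** * Points at given distances from two points *)

Section NormedSpace.
Variables (R : realType) (V : normedModType R).
Implicit Types (x y e : V) (s t : R).

Definition independent2 x e : Prop :=
  forall s t, s *: x + t *: e = 0 -> s = 0 /\ t = 0.

(** As [t] runs from [1] to [-1], [fan x e t] runs through the directions of the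
    half-plane bounded by the line of [x] that contains [e], from [x] to [- x].
    It is left unnormalized so that it depends continuously on all parameters;
    points of the sphere are handled through equations multiplied by its norm. *)
Definition fan x e t : V := t *: x + (1 - `|t|) *: e.

Lemma fan_neq0 x e t : independent2 x e -> fan x e t != 0.
Proof.
move=> ind; apply/eqP => /ind[->]; rewrite normr0 subr0 => /eqP.
by rewrite oner_eq0.
Qed.

(** On the half-circle of radius [a] the distance to [d *: x] goes from
    [`|a - d|] to [a + d]. *)
Lemma sphere_meet x e (a b d : R) : `|x| = 1 -> independent2 x e ->
  0 <= a -> 0 <= d -> `|a - d| <= b <= a + d ->
  exists s t, [/\ 0 <= t, `|t *: e + s *: x| = a &
                  `|t *: e + s *: x - d *: x| = b].
Proof.
move=> x1 ind a0 d0 /andP[ab ba].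
pose f t := `|a *: fan x e t - (`|fan x e t| * d) *: x| - b * `|fan x e t|.
have fan_cont : continuous (fan x e).
  move=> t; apply: cvgD; first by apply: cvgZr_tmp; exact: cvg_id.
  apply: cvgZr_tmp; apply: cvgB; first exact: cvg_cst.
  by apply: cvg_norm; exact: cvg_id.
have f_cont : continuous f.
  move=> t; apply: cvgB; last first.
    by apply: cvgM; [exact: cvg_cst|apply: cvg_norm; exact: fan_cont].
  apply: cvg_norm; apply: cvgB; first by apply: cvgZl_tmp; exact: fan_cont.
  apply: cvgZr_tmp; apply: cvgM; last exact: cvg_cst.
  by apply: cvg_norm; exact: fan_cont.
have fan1 : fan x e 1 = x by rewrite /fan normr1 subrr scale0r addr0 scale1r.
have fanN1 : fan x e (-1) = - x.
  by rewrite /fan normrN1 subrr scale0r addr0 scaleN1r.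
have f1 : f 1 <= 0.
  by rewrite /f fan1 x1 mulr1 mul1r subr_le0 -scalerBl normrZ x1 mulr1.
have fN1 : 0 <= f (-1).
  rewrite /f fanN1 normrN x1 mulr1 mul1r subr_ge0.
  by rewrite scalerN -opprD normrN -scalerDl normrZ x1 mulr1 ger0_norm ?addr_ge0.
have [|||c cI fc] := @IVT R f (-1) 1 0.
- by rewrite (le_trans _ ler01)// oppr_le0.
- exact: continuous_subspaceT.
- by rewrite ge_min le_max f1 fN1 orbT.
pose n := `|fan x e c|.
have n0 : 0 < n by rewrite normr_gt0 fan_neq0.
have zE : a / n * (1 - `|c|) *: e + (a / n * c) *: x = (a / n) *: fan x e c.
  by rewrite /fan; lin_coefficients R [:: x; e]; ring.
exists (a / n * c), (a / n * (1 - `|c|)); split.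
- rewrite mulr_ge0 ?divr_ge0 ?(ltW n0)// subr_ge0 ler_norml.
  by move: cI; rewrite in_itv.
- by rewrite zE normrZ ger0_norm ?divr_ge0 ?(ltW n0)// divfK ?gt_eqF.
- have -> : a / n * (1 - `|c|) *: e + a / n * c *: x - d *: x =
      n^-1 *: (a *: fan x e c - (n * d) *: x).
    by rewrite /fan; lin_coefficients R [:: x; e]; field; rewrite gt_eqF.
  rewrite normrZ ger0_norm ?invr_ge0 ?ltW//.
  by move/subr0_eq: fc => ->; rewrite mulrC mulfK// gt_eqF.
Qed.

Lemma norm_convex y x (a b c : R) : a <= b <= c ->
  (c - a) * `|y + b *: x| <= (c - b) * `|y + a *: x| + (b - a) * `|y + c *: x|.
Proof.
move=> /andP[ab bc].
have split_b : (c - a) *: (y + b *: x) =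
    (c - b) *: (y + a *: x) + (b - a) *: (y + c *: x).
  by lin_coefficients R [:: x; y]; ring.
have nZ (k : R) (v : V) : 0 <= k -> k * `|v| = `|k *: v|.
  by move=> k0; rewrite normrZ ger0_norm.
by rewrite !nZ ?subr_ge0 ?(le_trans ab)// split_b ler_normD.
Qed.

(** The unit circles around [0] and [x] meet, on one side of the line of [x], at
    a single height.  If [y'] is a common point, the line parallel to [x] at a
    smaller height passes through [r *: y'], of norm [r < 1].  The convex function
    [u] is less than [1] there and at most [1] one unit to the left, so it is less
    than [1] on an interval longer than one unit, and it is monotone on either
    side of it; so it cannot take the value [1] at both ends of a unit interval. *)
Lemma circle_meet_height y' y x (r c : R) : 0 <= r < 1 -> `|x| = 1 ->
  `|y'| = 1 -> `|y' - x| = 1 -> y = r *: y' + c *: x ->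
  `|y| = 1 -> `|y - x| = 1 -> False.
Proof.
move=> /andP[r0 r1] x1 y'1 y'x1 -> yc yc1.
pose u t := `|r *: y' + t *: x|.
have u0 : u 0 = r by rewrite /u scale0r addr0 normrZ y'1 mulr1 ger0_norm.
have uN1 : u (-1) <= 1.
  have -> : u (-1) = `|r *: (y' - x) + (r - 1) *: x|.
    by congr (`|_|); lin_coefficients R [:: x; y']; ring.
  rewrite (le_trans (ler_normD _ _))// !normrZ x1 y'x1 !mulr1 ger0_norm//.
  by rewrite ler0_norm; lra.
have uc : u c = 1 by [].
have uc1 : u (c - 1) = 1.
  rewrite -[RHS]yc1; congr (`|_|); lin_coefficients R [:: x; y']; ring.
have conv a b d : a <= b <= d -> (d - a) * u b <= (d - b) * u a + (b - a) * u d.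
  exact: norm_convex.
have [c0|c0] := lerP c 0.
  have [cN1|cN1] := lerP c (-1).
    by have := conv (c - 1) c 0; rewrite uc uc1 u0; nra.
  by have := conv (-1) c 0; rewrite uc u0; nra.
have [c1|c1] := lerP c 1.
  by have := conv (-1) (c - 1) 0; rewrite uc1 u0; nra.
by have := conv 0 (c - 1) c; rewrite uc1 u0 uc; nra.
Qed.

(** At their common height the two unit circles share a whole segment: [u] takes
    the value [1] at [-1], [0], [s - 1] and [s], and a convex function that does
    so is constant between [-1] and [s]. *)
Lemma circle_meet_segment y x (s t : R) : 0 <= t <= s ->
  `|y| = 1 -> `|y - x| = 1 -> `|y + s *: x| = 1 -> `|y + s *: x - x| = 1 ->
  `|y + t *: x| = 1 /\ `|y + t *: x - x| = 1.
Proof.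
move=> /andP[t0 ts] y1 yx1 ys1 ysx1.
pose u t := `|y + t *: x|.
have shift1 k : `|y + k *: x - x| = u (k - 1).
  by congr (`|_|); lin_coefficients R [:: x; y]; ring.
have u0 : u 0 = 1 by rewrite /u scale0r addr0.
have uN1 : u (-1) = 1 by rewrite /u scaleN1r.
have us : u s = 1 by [].
have us1 : u (s - 1) = 1 by rewrite -shift1.
have conv a b d : a <= b <= d -> (d - a) * u b <= (d - b) * u a + (b - a) * u d.
  exact: norm_convex.
rewrite shift1 -/(u t).
have [->|t_neq0] := eqVneq t 0; first by rewrite sub0r u0 uN1.
have [->|t_s] := eqVneq t s; first by rewrite us us1.
have tp : 0 < t by rewrite lt_neqAle eq_sym t_neq0.
have st : t < s by rewrite lt_neqAle t_s.
split; apply: le_anti; apply/andP; split.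
- by have := conv 0 t s; rewrite u0 us; nra.
- by have := conv (-1) 0 t; rewrite u0 uN1; nra.
- by have := conv (-1) (t - 1) (s - 1); rewrite us1 uN1; nra.
- by have := conv (t - 1) (s - 1) s; rewrite us1 us; nra.
Qed.

End NormedSpace.

(** * Four equidistant points in dimension three *)

(** The projections of [A] and [B] to the first coordinate are closed, by
    compactness, and cover the interval; as this is connected they meet.  It is
    the intermediate value theorem for a function with several values. *)
Lemma closed_cover_meet (R : realType) (A B : set (R * R)) :
  let I := [set t : R | -1 <= t <= 1] in
  closed A -> closed B ->
  (forall s, I s -> exists2 t, I t & A (s, t) \/ B (s, t)) ->
  (exists s t, [/\ I s, I t & A (s, t)]) ->
  (exists s t, [/\ I s, I t & B (s, t)]) ->
  exists s t t', [/\ I s, I t, I t', A (s, t) & B (s, t')].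
Proof.
move=> I clA clB cover [sA [tA [sAI tAI inA]]] [sB [tB [sBI tBI inB]]].
have IE : I = `[-1, 1]%classic by apply/seteqP; split=> t; rewrite /= in_itv.
have cI : compact I by rewrite IE; exact: segment_compact.
pose proj (D : set (R * R)) := fst @` (D `&` (I `*` I)).
have proj_closed D : closed D -> closed (proj D).
  move=> clD; apply: compact_closed; first exact: Rhausdorff.
  apply: continuous_compact.
    by apply: continuous_subspaceT => p; exact: cvg_fst.
  by rewrite setIC; apply: compact_closedI => //; exact: compact_setX.
apply: contrapT => no_meet.
have disj s : proj A s -> proj B s -> False.
  move=> [[a t] [At [/= sI tI]] /= as_]; rewrite as_ in At sI.
  move=> [[s' t'] [Bt [/= _ t'I]] /= e].
  by rewrite e in Bt; apply: no_meet; exists s, t, t'.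
have AE : I `&` proj A = I.
  have /(_ (I `&` proj A)) := @segment_connected R (-1) 1; rewrite -IE; apply.
  - by exists sA; split=> //; exists (sA, tA).
  - exists (~` proj B); first by rewrite openC; exact: proj_closed.
    apply/seteqP; split=> s [sI sAB]; split=> //; first by move=> /(disj s sAB).
    have [t tI [At|Bt]] := cover s sI; first by exists (s, t).
    by case: sAB; exists (s, t).
  - by exists (proj A) => //; exact: proj_closed.
have [_ ] : (I `&` proj A) sB by rewrite AE.
by move/disj; apply; exists (sB, tB).
Qed.

Section Petty.
Variables (R : realType) (V : normedModType R).
Implicit Types (x y z e : V).

(** The third vertices of the equilateral triangles on the side from [0] to
    [x]. *)
Definition apex x y : Prop := `|y| = 1 /\ `|y - x| = 1.

Lemma apex_opp x y : apex x y -> apex x (x - y).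
Proof.
move=> [y1 yx1]; split; first by rewrite distrC.
by rewrite addrAC subrr add0r normrN.
Qed.

(** Two apices in the same half-plane differ by a multiple of [x]. *)
Lemma apex_same_side x e y y' (s t s' t' : R) : `|x| = 1 -> 0 <= t -> 0 <= t' ->
  y = t *: e + s *: x -> y' = t' *: e + s' *: x ->
  apex x y -> apex x y' -> exists k, y' = y + k *: x.
Proof.
move=> x1 t0 t'0 yE y'E [y1 yx1] [y'1 y'x1].
have lower (r r' a a' : R) z z' : 0 <= r -> r < r' ->
    z = r *: e + a *: x -> z' = r' *: e + a' *: x ->
    apex x z -> apex x z' -> False.
  move=> r0 rr' zE z'E [z1 zx1] [z'1 z'x1].
  have r'0 : 0 < r' by apply: le_lt_trans rr'.
  apply: (@circle_meet_height _ _ z' z x (r / r') (a - r / r' * a')) => //.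
    by rewrite divr_ge0 ?(ltW r'0)//= ltr_pdivrMr// mul1r.
  by rewrite zE z'E; lin_coefficients R [:: x; e]; field; rewrite gt_eqF.
have [tt'|t't|tE] := ltgtP t t'.
- by have := lower _ _ _ _ _ _ t0 tt' yE y'E; case.
- by have := lower _ _ _ _ _ _ t'0 t't y'E yE; case.
- exists (s' - s); rewrite y'E yE -tE.
  by lin_coefficients R [:: x; e]; ring.
Qed.

Lemma fan_onto x e y (s t : R) : 0 <= t -> y = t *: e + s *: x -> `|y| = 1 ->
  exists2 r, -1 <= r <= 1 & fan x e r = `|fan x e r| *: y.
Proof.
move=> t0 yE y1; pose m := `|s| + t.
have m0 : 0 < m.
  rewrite lt_neqAle addr_ge0// andbT eq_sym; apply/eqP => m0.
  have s0 : s = 0.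
    apply/eqP; rewrite -normr_eq0; apply/eqP.
    by rewrite /m in m0; have := normr_ge0 s; lra.
  have t00 : t = 0 by move: m0; rewrite /m s0 normr0 add0r.
  by move/eqP: y1; rewrite yE s0 t00 !scale0r addr0 normr0 eq_sym oner_eq0.
have fanE : fan x e (s / m) = m^-1 *: y.
  rewrite /fan yE normrM normfV (gtr0_norm m0) /m.
  by lin_coefficients R [:: x; e]; field; rewrite gt_eqF.
exists (s / m); last by rewrite fanE normrZ y1 mulr1 gtr0_norm// invr_gt0.
by rewrite -ler_norml normrM normfV (gtr0_norm m0) ler_pdivrMr// mul1r lerDl.
Qed.

Lemma fan_coords x e y (r : R) : independent2 x e -> -1 <= r <= 1 ->
  fan x e r = `|fan x e r| *: y -> exists s t, 0 <= t /\ y = t *: e + s *: x.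
Proof.
move=> ind r1 fanE; have := fan_neq0 r ind; rewrite -normr_gt0.
set n := `|_| in fanE * => n0.
exists (r / n), ((1 - `|r|) / n); split.
  by rewrite divr_ge0 ?(ltW n0)// subr_ge0 ler_norml.
rewrite -[y](scalerK (lt0r_neq0 n0)) -fanE /fan.
by lin_coefficients R [:: x; e]; ring.
Qed.

(** The half-planes bounded by the line of [x] are indexed by [s] in [[-1, 1]],
    from that of [- e] to that of [e].  The apices [y1] over [-1] and [y = x - y1]
    over [1] are at distance at least one.  Each half-plane contains an apex at
    distance at most one from [y] or one at distance at least one, and
    [closed_cover_meet] finds a half-plane with both; the segment between the two
    consists of apices and contains one at distance exactly one. *)
Lemma four_equidistant_points x e e' : `|x| = 1 ->
  (forall r s t : R, r *: x + s *: e + t *: e' = 0 ->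
    [/\ r = 0, s = 0 & t = 0]) ->
  exists y z, [/\ apex x y, apex x z & `|z - y| = 1].
Proof.
move=> x1 ind.
pose w (s : R) := fan e e' s.
have indw s : independent2 x (w s).
  move=> a b eq0; have [] := ind a (b * s) (b * (1 - `|s|)).
    by rewrite -{}eq0 /w /fan; lin_coefficients R [:: x; e; e']; ring.
  move=> -> bs bs'; split=> //; apply/eqP; move/eqP: bs; rewrite mulf_eq0.
  by case/orP => // /eqP s0; move: bs'; rewrite s0 normr0 subr0 mulr1 => ->.
have ex_apex s : exists a b y, [/\ 0 <= b, y = b *: w s + a *: x & apex x y].
  have [|a [b [b0 y1 yx1]]] :=
      @sphere_meet R V x (w s) 1 1 1 x1 (indw s) ler01 ler01.
    by rewrite subrr normr0 ler01 lerDl ler01.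
  exists a, b, (b *: w s + a *: x); split=> //; split=> //.
  by rewrite -[in RHS]yx1 scale1r.
have [a1 [b1 [y1 [b1_ge0 y1E apex_y1]]]] := ex_apex (-1).
have wN1 : w (-1) = - e by rewrite /w /fan normrN1 subrr scale0r addr0 scaleN1r.
have w1 : w 1 = e by rewrite /w /fan normr1 subrr scale0r addr0 scale1r.
pose y := x - y1; have apex_y : apex x y := apex_opp apex_y1.
have yE : y = b1 *: w 1 + (1 - a1) *: x.
  by rewrite /y y1E wN1 w1; lin_coefficients R [:: x; e]; ring.
have y1_far : 1 <= `|y1 - y|.
  have -> : y1 - y = 2 *: y1 - x.
    by rewrite /y; lin_coefficients R [:: x; y1]; ring.
  rewrite (le_trans _ (lerB_dist _ _))// normrZ x1 apex_y1.1 ger0_norm//; lra.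
pose F (p : R * R) := fan x (w p.1) p.2.
(* [gap z p] has the sign of [`|u - z| - 1], where [u] is the unit vector in the
   direction of [F p]; see [gapE]. *)
pose gap z (p : R * R) := `|F p - `|F p| *: z| - `|F p|.
have gapE z z' p : F p = `|F p| *: z -> gap z' p = `|F p| * (`|z - z'| - 1).
  move=> Fz; rewrite /gap {1}Fz -scalerBr normrZ normr_id; ring.
have fan_cont (T : topologicalType) (f : T -> R) (g h : T -> V) :
    continuous f -> continuous g -> continuous h ->
    continuous (fun q => fan (g q) (h q) (f q)).
  move=> cf cg ch q; apply: cvgD; first by apply: cvgZ; [exact: cf|exact: cg].
  apply: cvgZ; last exact: ch.
  by apply: cvgB; [exact: cvg_cst|apply: cvg_norm; exact: cf].
have F_cont : continuous F.
  apply: (fan_cont) => [p|p|p]; first exact: cvg_snd.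
    exact: cvg_cst.
  by apply: (fan_cont) => q; [exact: cvg_fst|exact: cvg_cst|exact: cvg_cst].
have gap_cont z : continuous (gap z).
  move=> p; have nF : `|F q| @[q --> p] --> `|F p|.
    by apply: cvg_norm; exact: F_cont.
  apply: cvgB => //; apply: cvg_norm; apply: cvgB; first exact: F_cont.
  by apply: cvgZr_tmp.
have gap_closed z D : closed D -> closed (gap z @^-1` D).
  by move=> clD; have /continuous_closedP := gap_cont z; apply.
have F_gt0 p : 0 < `|F p| by rewrite normr_gt0 fan_neq0.
pose A := gap x @^-1` [set t | t = 0] `&` gap y @^-1` [set t | t <= 0].
pose B := gap x @^-1` [set t | t = 0] `&` gap y @^-1` [set t | 0 <= t].
have param s z a b : 0 <= b -> z = b *: w s + a *: x -> apex x z ->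
    exists t, [/\ -1 <= t <= 1, `|z - y| <= 1 -> A (s, t) &
                  1 <= `|z - y| -> B (s, t)].
  move=> b0 zE [z1 zx1]; have [t tI Fz] := fan_onto b0 zE z1.
  have Fz' : F (s, t) = `|F (s, t)| *: z by [].
  exists t; split=> // zy; split; rewrite /= (gapE z)// ?zx1 ?subrr ?mulr0//.
    by rewrite pmulr_rle0// subr_le0.
  by rewrite pmulr_rge0// subr_ge0.
have unparam s t : -1 <= t <= 1 -> gap x (s, t) = 0 -> exists a b z,
    [/\ 0 <= b, z = b *: w s + a *: x, apex x z &
        gap y (s, t) = `|F (s, t)| * (`|z - y| - 1)].
  move=> tI gx; pose z := `|F (s, t)|^-1 *: F (s, t).
  have Fz : F (s, t) = `|F (s, t)| *: z by rewrite scalerKV// gt_eqF.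
  have [a [b [b0 zE]]] := fan_coords (indw s) tI Fz.
  exists a, b, z; split=> //; last exact: gapE.
  split; first by rewrite /z normrZ normfV normr_id mulVf// gt_eqF.
  move/eqP: gx; rewrite (gapE z)// mulf_eq0 gt_eqF//= subr_eq0 => /eqP //.
have [|||||s [t [t' [_ tI t'I [/= ax ay] [/= bx by_]]]]] :=
  @closed_cover_meet R A B.
- by apply: closedI; apply: gap_closed; [exact: closed_eq|exact: closed_le].
- by apply: closedI; apply: gap_closed; [exact: closed_eq|exact: closed_ge].
- move=> s _; have [a [b [z [b0 zE az]]]] := ex_apex s.
  have [t [tI At Bt]] := param _ _ _ _ b0 zE az.
  by exists t => //; have [/At|/ltW/Bt] := lerP `|z - y| 1; [left|right].
- have [t [tI At _]] := param _ _ _ _ b1_ge0 yE apex_y.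
  exists 1, t; split=> //=; first by rewrite lexx andbT; lra.
  by apply: At; rewrite subrr normr0 ler01.
- have [t [tI _ Bt]] := param _ _ _ _ b1_ge0 y1E apex_y1.
  exists (-1), t; split=> //=; first by rewrite lexx/=; lra.
  exact: Bt.
have [a [b [z [b0 zE az gz]]]] := unparam _ _ tI ax.
have [a' [b' [z' [b'0 z'E az' gz']]]] := unparam _ _ t'I bx.
have zy : `|z - y| <= 1 by move: ay; rewrite gz pmulr_rle0// subr_le0.
have z'y : 1 <= `|z' - y| by move: by_; rewrite gz' pmulr_rge0// subr_ge0.
have [k z'k] := apex_same_side x1 b0 b'0 zE z'E az az'.
(* The segment lemma wants a nonnegative length, hence the exchange of [z] and
   [z'] when [k] is negative. *)
have segment c : 0 <= c <= 1 -> apex x (z + (c * k) *: x).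
  case: (az) (az') => z1 zx1 [z'1 z'x1] /andP[c0 c1].
  have [k0|/ltW k0] := lerP 0 k.
    apply: (circle_meet_segment (s := k)) => //; rewrite -?z'k//.
    by rewrite mulr_ge0// ler_piMl.
  have zk : z = z' + (- k) *: x.
    by rewrite z'k; lin_coefficients R [:: x; z]; ring.
  have -> : z + (c * k) *: x = z' + ((1 - c) * - k) *: x.
    by rewrite z'k; lin_coefficients R [:: x; z]; ring.
  apply: (circle_meet_segment (s := - k)) => //; rewrite -?zk//.
  by rewrite mulr_ge0 ?ler_piMl; lra.
pose h c := `|z + (c * k) *: x - y|.
have h_cont : continuous h.
  move=> c; apply: cvg_norm; apply: cvgB; last exact: cvg_cst.
  apply: cvgD; first exact: cvg_cst.
  by apply: cvgZr_tmp; apply: cvgM; [exact: cvg_id|exact: cvg_cst].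
have h0 : h 0 <= 1 by rewrite /h mul0r scale0r addr0.
have h1 : 1 <= h 1 by rewrite /h mul1r -z'k.
have [||c cI hc] := @IVT R h 0 1 1 ler01.
- exact: continuous_subspaceT.
- by rewrite ge_min le_max h0 h1 orbT.
exists y, (z + (c * k) *: x); split=> //.
by apply: segment; move: cI; rewrite in_itv.
Qed.

End Petty.

(** * Planes with four equidistant points *)

Section Planes.
Variable (R : realType).

(** The coefficients of the [u i] on the [v j] form a matrix with more rows than
    columns, whose row kernel is not zero. *)
Lemma linear_dependence (V : lmodType R) (n m : nat) (v : 'I_n -> V)
    (u : 'I_m -> V) : spanning v -> (n < m)%N ->
  exists a : 'I_m -> R, (exists i, a i != 0) /\ \sum_i a i *: u i = 0.
Proof.
move=> span_v nm; have [c cE] := choice (fun i => span_v (u i)).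
pose M : 'M[R]_(m, n) := \matrix_(i, j) c i j.
have kM : kermx M != 0.
  by rewrite kermx_eq0 /row_free neq_ltn (leq_ltn_trans _ nm)// rank_leq_col.
pose r := nz_row (kermx M).
have /sub_kermxP rM : (r <= kermx M)%MS by exact: nz_row_sub.
exists (r 0); split; first by apply/rV0Pn; rewrite nz_row_eq0.
under eq_bigr => i _ do rewrite cE scaler_sumr.
rewrite exchange_big big1//= => j _.
under eq_bigr => i _ do rewrite scalerA.
have rMj : \sum_i r 0 i * c i j = 0.
  have := congr1 (fun N : 'rV_n => N 0 j) rM.
  rewrite [LHS]mxE [RHS]mxE; apply: etrans.
  by apply: eq_bigr => i _; rewrite mxE.
by rewrite -scaler_suml rMj scale0r.
Qed.

Lemma plane_dependence (V : lmodType R) (x y z : V) : dim_eq V 2 ->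
  exists a b c : R, (a, b, c) != 0 /\ a *: x + b *: y + c *: z = 0.
Proof.
move=> [v [_ /linear_dependence dep]].
have [a [[i ai] aE]] := dep _ (fun i : 'I_3 => [:: x; y; z]`_i) isT.
exists (a ord0), (a (lift ord0 ord0)), (a (lift ord0 (lift ord0 ord0))).
split; last by move: aE; rewrite !big_ord_recl big_ord0 addr0 addrA.
apply: contraNneq ai => -[a0 a1 a2].
case: (unliftP ord0 i) => [j ->|->]; last by rewrite a0.
case: (unliftP ord0 j) => [k ->|->]; last by rewrite a1.
by rewrite (ord1 k) a2.
Qed.

Definition equidistant4 (V : normedModType R) (p q r s : V) : Prop :=
  [/\ `|p - q| = 1, `|p - r| = 1 & `|p - s| = 1] /\
  [/\ `|q - r| = 1, `|q - s| = 1 & `|r - s| = 1].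

Section Equidistant.
Variable V : normedModType R.
Implicit Types p q r s : V.

(** If [p] were a convex combination of [q], [r], [s] with weight [b] on [q], then
    [q - p] would be a combination of [q - r] and [q - s] with total weight
    [1 - b], so that [1 <= 1 - b]. *)
Lemma equidistant4_not_hull p q r s (b c d : R) : equidistant4 p q r s ->
  0 <= b -> 0 <= c -> 0 <= d -> b *: q + c *: r + d *: s = (b + c + d) *: p ->
  [/\ b = 0, c = 0 & d = 0].
Proof.
have first_coef p' q' r' s' (b' c' d' : R) : equidistant4 p' q' r' s' ->
    0 <= b' -> 0 <= c' -> 0 <= d' ->
    b' *: q' + c' *: r' + d' *: s' = (b' + c' + d') *: p' -> b' = 0.
  move=> [[pq _ _] [qr qs _]] b0 c0 d0 hull.
  have := ler_normD (c' *: (q' - r')) (d' *: (q' - s')).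
  have -> : c' *: (q' - r') + d' *: (q' - s') = (b' + c' + d') *: (q' - p').
    rewrite [in RHS]scalerBr -hull.
    by lin_coefficients R [:: q'; r'; s']; ring.
  rewrite !normrZ qr qs distrC pq !ger0_norm ?addr_ge0//; lra.
move=> eq4 b0 c0 d0 hull; split.
- exact: (first_coef p q r s b c d).
- apply: (first_coef p r s q c d b) => //.
    by move: eq4 => [[pq pr ps] [qr qs rs]]; split; split; rewrite // distrC.
  rewrite (_ : c + d + b = b + c + d); last by ring.
  by rewrite -hull; lin_coefficients R [:: q; r; s]; ring.
- apply: (first_coef p s q r d b c) => //.
    by move: eq4 => [[pq pr ps] [qr qs rs]]; split; split; rewrite // distrC.
  rewrite (_ : d + b + c = b + c + d); last by ring.
  by rewrite -hull; lin_coefficients R [:: q; r; s]; ring.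
Qed.

(** The vectors [x] and [y] span a copy of the plane with norm [|s| + |t|]; see
    [l1_pair_norm]. *)
Definition l1_pair (x y : V) : Prop :=
  [/\ `|x| = 1, `|y| = 1, `|x + y| = 2 & `|x - y| = 2].

(** Here the segments from [p] to [q] and from [r] to [s] cross.  Each of the four
    sides has length one, and going through the crossing point bounds it by a sum
    of two parts of the diagonals, which also have length one.  The four bounds
    force the crossing point to be the midpoint of both, and then [x + y] and
    [x - y] are twice a side. *)
Lemma equidistant4_crossing p q r s (a b c d : R) : equidistant4 p q r s ->
  0 <= a -> 0 <= b -> 0 <= c -> 0 <= d -> a + b = c + d -> 0 < a + b ->
  a *: p + b *: q = c *: r + d *: s -> l1_pair (p - q) (r - s).
Proof.
move=> [[pq pr ps] [qr qs rs]] a0 b0 c0 d0 abcd n0 cross.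
have bound (k l : R) (u v w : V) : 0 <= k -> 0 <= l ->
    `|u| = 1 -> `|v| = 1 -> `|w| = 1 ->
    k *: u + l *: v = (a + b) *: w -> a + b <= k + l.
  move=> k0 l0 u1 v1 w1 E; have := ler_normD (k *: u) (l *: v).
  by rewrite E !normrZ u1 v1 w1 !mulr1 !ger0_norm ?addr_ge0.
have bd : a + b <= b + d.
  apply: (bound b d (p - q) (s - r) (p - r)) => //; first by rewrite distrC.
  rewrite [RHS](_ : _ = (a *: p + b *: q) + b *: (p - q) - (a + b) *: r).
    by rewrite cross abcd; lin_coefficients R [:: p; q; r; s]; ring.
  by lin_coefficients R [:: p; q; r; s]; ring.
have ac : a + b <= a + c.
  apply: (bound a c (q - p) (r - s) (q - s)) => //; first by rewrite distrC.
  rewrite [RHS](_ : _ = (a *: p + b *: q) + a *: (q - p) - (a + b) *: s).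
    by rewrite cross abcd; lin_coefficients R [:: p; q; r; s]; ring.
  by lin_coefficients R [:: p; q; r; s]; ring.
have bc : a + b <= b + c.
  apply: (bound b c (p - q) (r - s) (p - s)) => //.
  rewrite [RHS](_ : _ = (a *: p + b *: q) + b *: (p - q) - (a + b) *: s).
    by rewrite cross abcd; lin_coefficients R [:: p; q; r; s]; ring.
  by lin_coefficients R [:: p; q; r; s]; ring.
have ad : a + b <= a + d.
  apply: (bound a d (q - p) (s - r) (q - r)) => //; try by rewrite distrC.
  rewrite [RHS](_ : _ = (a *: p + b *: q) + a *: (q - p) - (a + b) *: r).
    by rewrite cross abcd; lin_coefficients R [:: p; q; r; s]; ring.
  by lin_coefficients R [:: p; q; r; s]; ring.
have ba : b = a by lra.
have ca : c = a by lra.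
have da : d = a by lra.
have sE : s = p + q - r.
  have an0 : a != 0 by rewrite gt_eqF; lra.
  apply: (scalerI an0); move: cross; rewrite ba ca da => cross.
  rewrite [LHS](_ : _ = (a *: r + a *: s) - a *: r); last first.
    by lin_coefficients R [:: r; s]; ring.
  by rewrite -cross; lin_coefficients R [:: p; q; r]; ring.
split=> //.
- have -> : p - q + (r - s) = 2 *: (p - s).
    by rewrite sE; lin_coefficients R [:: p; q; r]; ring.
  by rewrite normrZ ps mulr1 ger0_norm.
- have -> : p - q - (r - s) = 2 *: (p - r).
    by rewrite sE; lin_coefficients R [:: p; q; r]; ring.
  by rewrite normrZ pr mulr1 ger0_norm.
Qed.

(** Four points of a plane satisfy an affine relation.  Up to a global sign,
    either one coefficient is alone with its sign, against
    [equidistant4_not_hull], or there are two of each sign and the segments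
    joining the points of equal sign cross. *)
Lemma equidistant4_l1_pair p q r s : dim_eq V 2 -> equidistant4 p q r s ->
  exists x y, l1_pair x y.
Proof.
move=> dim2 eq4.
have [b [c [d [bcd_neq0 E]]]] := plane_dependence (q - p) (r - p) (s - p) dim2.
wlog sum_ge0 : b c d bcd_neq0 E / 0 <= b + c + d.
  move=> H; have [/H|neg] := lerP 0 (b + c + d); first exact.
  apply: (H (- b) (- c) (- d)); last by lra.
  - apply: contra_neq bcd_neq0 => -[/eqP + /eqP + /eqP].
    by rewrite !oppr_eq0 => /eqP-> /eqP-> /eqP->.
  - by rewrite !scaleNr -!opprD E oppr0.
have ne0 : ~ [/\ b = 0, c = 0 & d = 0].
  by move=> [b0 c0 d0]; move: bcd_neq0; rewrite b0 c0 d0 eqxx.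
have hullE : b *: q + c *: r + d *: s = (b + c + d) *: p.
  by apply/subr0_eq; rewrite -[RHS]E; lin_coefficients R [:: p; q; r; s]; ring.
have [eqp eqpr eqps] : [/\ equidistant4 p q r s, equidistant4 p r q s &
    equidistant4 p s q r].
  by case: eq4 => [[pq pr ps] [qr qs rs]]; do 3?split; rewrite // distrC.
have eqq : equidistant4 q p r s.
  by case: eq4 => [[pq pr ps] [qr qs rs]]; do 3?split; rewrite // distrC.
have eqr : equidistant4 r p q s.
  by case: eq4 => [[pq pr ps] [qr qs rs]]; do 3?split; rewrite // distrC.
have eqs : equidistant4 s p q r.
  by case: eq4 => [[pq pr ps] [qr qs rs]]; do 3?split; rewrite // distrC.
have [b0|b0] := lerP 0 b; have [c0|c0] := lerP 0 c; have [d0|d0] := lerP 0 d.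
- by have /ne0 := equidistant4_not_hull eqp b0 c0 d0 hullE.
- exists (p - s), (q - r).
  have cross : (b + c + d) *: p + (- d) *: s = b *: q + c *: r.
    by rewrite -hullE; lin_coefficients R [:: q; r; s]; ring.
  by apply: (equidistant4_crossing eqps _ _ _ _ _ _ cross) => //; lra.
- exists (p - r), (q - s).
  have cross : (b + c + d) *: p + (- c) *: r = b *: q + d *: s.
    by rewrite -hullE; lin_coefficients R [:: q; r; s]; ring.
  by apply: (equidistant4_crossing eqpr _ _ _ _ _ _ cross) => //; lra.
- have hull : (b + c + d) *: p + (- c) *: r + (- d) *: s =
      (b + c + d + (- c) + (- d)) *: q.
    by rewrite -hullE; lin_coefficients R [:: q; r; s]; ring.
  by have [|||] := equidistant4_not_hull eqq _ _ _ hull; lra.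
- exists (p - q), (r - s).
  have cross : (b + c + d) *: p + (- b) *: q = c *: r + d *: s.
    by rewrite -hullE; lin_coefficients R [:: q; r; s]; ring.
  by apply: (equidistant4_crossing eqp _ _ _ _ _ _ cross) => //; lra.
- have hull : (b + c + d) *: p + (- b) *: q + (- d) *: s =
      (b + c + d + (- b) + (- d)) *: r.
    by rewrite -hullE; lin_coefficients R [:: q; r; s]; ring.
  by have [|||] := equidistant4_not_hull eqr _ _ _ hull; lra.
- have hull : (b + c + d) *: p + (- b) *: q + (- c) *: r =
      (b + c + d + (- b) + (- c)) *: s.
    by rewrite -hullE; lin_coefficients R [:: q; r; s]; ring.
  by have [|||] := equidistant4_not_hull eqs _ _ _ hull; lra.
- have neg : b + c + d < 0 by lra.
  by rewrite ltNge sum_ge0 in neg.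
Qed.

(** For [s >= t >= 0], writing [s (x + y) = (s x + t y) + (s - t) y] and taking
    norms gives the lower bound [2 s - (s - t)]. *)
Lemma l1_pair_norm x y (s t : R) : l1_pair x y ->
  `|s *: x + t *: y| = `|s| + `|t|.
Proof.
have nonneg (u v : V) (a b : R) : `|u| = 1 -> `|v| = 1 -> `|u + v| = 2 ->
    0 <= a -> 0 <= b -> `|a *: u + b *: v| = a + b.
  wlog ba : u v a b / b <= a.
    move=> H u1 v1 uv a0 b0; have [/H->//|/ltW ab] := lerP b a.
    by rewrite addrC H// 1?addrC.
  move=> u1 v1 uv a0 b0; apply: le_anti; apply/andP; split.
    by rewrite (le_trans (ler_normD _ _))// !normrZ u1 v1 !mulr1 !ger0_norm.
  have := ler_normD (a *: u + b *: v) ((a - b) *: v).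
  have -> : a *: u + b *: v + (a - b) *: v = a *: (u + v).
    by lin_coefficients R [:: u; v]; ring.
  rewrite !normrZ uv v1 !ger0_norm ?subr_ge0//; lra.
move=> [x1 y1 xy xyN].
wlog s0 : s t / 0 <= s.
  move=> H; have [/H//|/ltW s0] := lerP 0 s.
  by rewrite -normrN opprD -!scaleNr H ?oppr_ge0// !normrN.
have [t0|t0] := lerP 0 t.
  by rewrite nonneg// !ger0_norm.
rewrite -[t *: y]opprK -scalerN -scaleNr nonneg ?normrN//; last by lra.
by rewrite ger0_norm// ltr0_norm.
Qed.

(** The inverse isometry sends the point of coordinates [u], [w] to
    [(u + w) / 2 x + (u - w) / 2 y], since [max |u| |w|] is half of
    [|u + w| + |u - w|]. *)
Lemma l1_pair_linf2 x y : dim_eq V 2 -> l1_pair x y ->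
  isometrically_isomorphic V (linf2 R).
Proof.
move=> dim2 xy.
pose g (r : 'rV[R]_2) : V :=
  ((r 0 0 + r 0 1) / 2) *: x + ((r 0 0 - r 0 1) / 2) *: y.
have g_norm (r : 'rV[R]_2) : `|g r| = `|r : linf2 R|.
  rewrite linf2_normE (l1_pair_norm _ _ xy) !normrM normfV.
  rewrite (ger0_norm (ler0n _ 2)).
  set u := r 0 0; set w := r 0 1; rewrite /Num.max.
  by case: ltrP; case: (ger0P (u + w)); case: (ger0P (u - w)); case: (ger0P u);
    case: (ger0P w) => *; lra.
have g_surj (v : V) : exists r : 'rV[R]_2, g r = v.
  have [a [b [c [abc E]]]] := plane_dependence x y v dim2.
  have c0 : c != 0.
    apply: contraNneq abc => c0; move: E.
    rewrite c0 scale0r addr0 => /(congr1 Num.norm).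
    rewrite (l1_pair_norm _ _ xy) normr0 => ab0.
    by move/eqP: ab0; rewrite paddr_eq0// !normr_eq0 => /andP[/eqP-> /eqP->].
  exists (\row_j (if j == 0 then - (a + b) / c else (b - a) / c)).
  rewrite /g !mxE/=; apply: (scalerI c0); apply/esym/subr0_eq.
  rewrite -[RHS]E; lin_coefficients R [:: x; y; v]; field; exact: c0.
have [f fK] := choice g_surj.
have g_lin (a : R) (r s : 'rV[R]_2) : g (a *: r + s) = a *: g r + g s.
  by rewrite /g !mxE; lin_coefficients R [:: x; y]; ring.
have g_inj : injective g.
  move=> r s rs; apply/eqP; rewrite -subr_eq0 -(@normr_eq0 _ (linf2 R)) -g_norm.
  by rewrite -[r - s]addrC -scaleN1r g_lin rs scaleN1r addNr normr0.
have f_lin : linear (f : V -> linf2 R).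
  by move=> a u v; apply: g_inj; rewrite g_lin !fK.
pose fL : {linear V -> linf2 R} :=
  HB.pack (f : V -> linf2 R) (GRing.isLinear.Build _ _ _ _ _ f_lin).
exists fL; split.
  by exists g => // r; apply: g_inj; rewrite fK.
by move=> v; rewrite -g_norm fK.
Qed.

End Equidistant.
End Planes.

(** * Flattening graphs into a plane *)

Section Spheres.
Variables (R : realType) (X : normedModType R).

Lemma ex_independent2 (x : X) : dim_ge X 2 -> x != 0 ->
  exists e, independent2 x e.
Proof.
move=> [v ind] x0.
have [|] := pselect (independent2 x (v ord0)); first by exists (v ord0).
have pair_eq0 (s t : R) :
    s *: v ord0 + t *: v (lift ord0 ord0) = 0 -> s = 0 /\ t = 0.
  move=> eq0; pose a (i : 'I_2) := if i == ord0 then s else t.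
  have a0 : forall i, a i = 0.
    by apply: ind; rewrite !big_ord_recl big_ord0 addr0.
  by split; [have := a0 ord0|have := a0 (lift ord0 ord0)].
move=> dep; have [s [t [E st]]] : exists s t : R,
    s *: x + t *: v ord0 = 0 /\ ~ (s = 0 /\ t = 0).
  apply: contrapT => nodep; apply: dep => s t E; apply: contrapT => st.
  by apply: nodep; exists s, t.
have s0 : s != 0.
  apply/eqP => s0; move: E; rewrite s0 scale0r add0r => t0; apply: st; split=> //.
  by have [] := pair_eq0 t 0; rewrite ?t0 ?scale0r ?addr0.
have xE : x = (- (t / s)) *: v ord0.
  apply: (scalerI s0); apply/subr0_eq; rewrite -[RHS]E.
  by lin_coefficients R [:: x; v ord0]; field.
have c0 : - (t / s) != 0 by apply: contra_neq x0 => c0; rewrite xE c0 scale0r.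
exists (v (lift ord0 ord0)) => a b; rewrite xE scalerA => /pair_eq0[/eqP].
by rewrite mulf_eq0 (negbTE c0) orbF => /eqP.
Qed.

Lemma dim_ge2_unit : dim_ge X 2 -> exists x : X, `|x| = 1.
Proof.
move=> [v ind]; exists (`|v ord0|^-1 *: v ord0).
have v0 : v ord0 != 0.
  apply/eqP => v0; pose a (i : 'I_2) := (i == ord0)%:R : R.
  have /(_ ord0)/eqP : forall i, a i = 0.
    by apply: ind; rewrite !big_ord_recl big_ord0 /a/= v0 scaler0 scale0r !addr0.
  by rewrite /a eqxx oner_eq0.
by rewrite normrZ normfV normr_id mulVf// normr_eq0.
Qed.

Lemma triangle_completion (u w : X) (a b : R) : dim_ge X 2 ->
  `|a - b| <= `|u - w| <= a + b ->
  exists z, `|z - u| = a /\ `|z - w| = b.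
Proof.
move=> dim2 /andP[]; set d := `|u - w|; rewrite ler_norml => /andP[ab1 ab2] dab.
have [x [x1 uwx]] : exists x : X, `|x| = 1 /\ w - u = d *: x.
  have [uw|uw] := eqVneq u w.
    have [x x1] := dim_ge2_unit dim2; exists x.
    by rewrite /d uw !subrr normr0 scale0r.
  have d0 : d != 0 by rewrite normr_eq0 subr_eq0.
  exists (d^-1 *: (w - u)); split; last by rewrite scalerKV.
  by rewrite normrZ normfV [`|w - u|]distrC -/d ger0_norm ?mulVf ?normr_ge0.
have [|e ind] := @ex_independent2 x dim2.
  by rewrite -normr_eq0 x1 oner_eq0.
have [|||s [t [_ za zb]]] := @sphere_meet R X x e a b d x1 ind.
- lra.
- exact: normr_ge0.
- by rewrite ler_norml; apply/andP; split; [apply/andP; split|]; lra.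
exists (u + (t *: e + s *: x)); split; first by rewrite addrAC subrr add0r.
by rewrite [u + _]addrC -addrA -(opprB w) uwx.
Qed.

Lemma ex_equidistant4 : dim_ge X 3 -> exists p q r s : X, equidistant4 p q r s.
Proof.
move=> [v ind].
have triple_eq0 (a b c : R) :
    a *: v ord0 + b *: v (lift ord0 ord0) +
      c *: v (lift ord0 (lift ord0 ord0)) = 0 ->
    [/\ a = 0, b = 0 & c = 0].
  move=> eq0; pose f (i : 'I_3) := [:: a; b; c]`_i.
  have f0 : forall i, f i = 0.
    by apply: ind; rewrite !big_ord_recl big_ord0 addr0 addrA.
  split; [exact: (f0 ord0)|exact: (f0 (lift ord0 ord0))|].
  exact: (f0 (lift ord0 (lift ord0 ord0))).
have v0 : v ord0 != 0.
  apply/eqP => v0; have [|/eqP] := triple_eq0 1 0 0.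
    by rewrite v0 scaler0 !scale0r !addr0.
  by rewrite oner_eq0.
pose x := `|v ord0|^-1 *: v ord0.
have x1 : `|x| = 1 by rewrite normrZ normfV normr_id mulVf// normr_eq0.
have [|y [z [[y1 yx] [z1 zx] zy]]] := four_equidistant_points
  (e := v (lift ord0 ord0)) (e' := v (lift ord0 (lift ord0 ord0))) x1.
  move=> a b c; rewrite /x scalerA => /triple_eq0[/eqP + -> ->].
  by rewrite mulf_eq0 invr_eq0 normr_eq0 (negbTE v0) orbF => /eqP->.
by exists 0, x, y, z; split; split; rewrite ?sub0r ?normrN// distrC.
Qed.

End Spheres.

Lemma K4_not_flattenable (R : realType) (X Y : normedModType R) :
  dim_eq X 2 -> ~ isometrically_isomorphic X (linf2 R) -> dim_ge Y 3 ->
  ~ flattenable X Y (complete 4).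
Proof.
move=> X2 XN Y3 /flattenableP flat.
have [p0 [p1 [p2 [p3 [[d01 d02 d03] [d12 d13 d23]]]]]] := ex_equidistant4 Y3.
have [q qp] := flat (fun i : 'I_4 => [:: p0; p1; p2; p3]`_i).
have [x [y xy]] : exists x y : X, l1_pair x y.
  apply: (@equidistant4_l1_pair _ _ (q (inord 0)) (q (inord 1)) (q (inord 2))
    (q (inord 3))) => //.
  by split; split; rewrite qp /= ?inordK// /complete_rel -val_eqE/= !inordK.
exact/XN/(l1_pair_linf2 X2 xy).
Qed.

Theorem theorem6p6 (R : realType) (X Y : normedModType R)
    (X_plane : dim_eq X 2)
    (X_not_linf2 : ~ isometrically_isomorphic X (linf2 R))
    (Y_dim : dim_ge Y 3)
    (G : sgraph) (G_edge : exists u v : G, adj u v) :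
  flattenable X Y G <-> ~ minor (complete 4) G.
Proof.
split=> [flat /flattenable_minor K4|].
  by apply: (K4_not_flattenable X_plane X_not_linf2 Y_dim); exact: K4.
apply: K4_minor_free_flattenable => u w a b.
by apply: triangle_completion; case: X_plane => v [ind _]; exists v.
Qed.
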